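(* Let $r>0$ be a real number and, for $p\in(0,1]$, let $X_{r,p}$ denote a negative binomial random variable with parameters $(r,p)$, that is, $$\mathbf{P}(X_{r,p}=l)=\binom{-r}{l}p^r(-q)^l=\binom{r+l-1}{l}p^rq^l,\qquad l=0,1,2,\ldots,$$ where $q=1-p$. Then for every real $y>0$, $$\inf_{0<p\le 1}\mathbf{P}\left(|X_{r,p}-\mathbf{E}[X_{r,p}]|\ge y\sqrt{\mathrm{Var}(X_{r,p})}\right)=0.$$
   Context: $\mathbf{P}$, $\mathbf{E}$ and $\mathrm{Var}$ denote probability, expectation and variance. Generalized binomial coefficients are used: $\binom{x}{l}=\frac{x(x-1)\cdots(x-l+1)}{l!}$ for real $x$ and integer $l\ge 0$ (with $\binom{x}{0}=1$), and $0^0=1$. *)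

(* Defs.v *)
From HB Require Import structures.
From mathcomp Require Export all_boot all_order all_algebra.
From mathcomp Require Import ring.
From mathcomp Require Export all_classical all_reals all_analysis.
Export Order.TTheory GRing.Theory Num.Theory.
Export numFieldNormedType.Exports.

Set Implicit Arguments.
Unset Strict Implicit.
Unset Printing Implicit Defensive.

Local Open Scope classical_set_scope.
Local Open Scope ring_scope.

Definition gbinom (R : realType) (x : R) (l : nat) : R :=
  (\prod_(i < l) (x - i%:R)) / l`!%:R.

(* The power p `^ r has a real exponent; the last power has a natural one, so
   it is 1 at p = 1, l = 0. *)
Definition nbinom_pmf (R : realType) (r p : R) (l : nat) : R :=
  gbinom (- r) l * p `^ r * (- (1 - p)) ^+ l.

Lemma gbinomN (R : realType) (r : R) (l : nat) :
  gbinom (- r) l = (-1) ^+ l * gbinom (r + l%:R - 1) l.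
Proof.
rewrite /gbinom mulrA; congr (_ / _).
rewrite (reindex_inj rev_ord_inj) /=.
rewrite -[in (-1) ^+ l](card_ord l) -prodr_const -big_split /=.
apply: eq_bigr => i _; rewrite mulN1r.
by rewrite natrB // -addn1 natrD; ring.
Qed.

Lemma nbinom_pmfE (R : realType) (r p : R) (l : nat) :
  nbinom_pmf r p l = gbinom (r + l%:R - 1) l * p `^ r * (1 - p) ^+ l.
Proof.
rewrite /nbinom_pmf gbinomN [(- (1 - p)) ^+ l]exprNn.
have <- : (-1) ^+ l * (-1) ^+ l * (gbinom (r + l%:R - 1) l * p `^ r * (1 - p) ^+ l)
  = gbinom (r + l%:R - 1) l * p `^ r * (1 - p) ^+ l.
  by rewrite -expr2 sqrr_sign mul1r.
ring.
Qed.

(* No mass is left outside the natural numbers: the values below sum to 1 when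
   0 < r and 0 < p <= 1. *)
Definition negative_binomial (R : realType) (d : measure_display)
    (T : measurableType d) (P : probability T R) (r p : R)
    (X : {RV P >-> R}) : Prop :=
  forall l : nat, pmf X l%:R = nbinom_pmf r p l.

(* Main.v *)
Require Import Defs.
From mathcomp Require Import measurable_realfun ring lra.

(** The infimum is approached as [p] tends to 1 from below, where the law
    concentrates at 0 faster than its standard deviation shrinks. With
    [q = 1 - p], the mean is [r * q / p] and the variance [r * q / p ^+ 2], so
    the value 0 lies at distance [r * q / p = Num.sqrt (r * q) * sigma] from
    the mean, [sigma] being the standard deviation: relative to [sigma] the
    mean itself tends to 0. As soon as [0 < r * q < y ^+ 2], the value 0 is
    less than [y * sigma] away from the mean, so the deviation event forces [X]
    to be nonzero and its probability is at most [1 - p `^ r]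
    ([negative_binomial_deviation]), which tends to 0. At [p = 1] itself the
    variance vanishes and the event is everything, hence the need to stay below
    1.

    What takes work is the mean and the variance, starting from nothing but the
    point masses. The negative binomial series
    [\sum_l c_l q ^ l = (1 - q) ^ (- r)] ([nbinom_seriesE]) shows that these
    masses sum to 1, so that [X] is almost surely a natural number and integrals
    of functions of [X] become series ([ge0_integral_pmf_nat]). The absorption
    identity [nbinom_coef_diffs] then reduces the first two moments to the series
    with parameters [r + 1] and [r + 2]. *)

Set Implicit Arguments.
Unset Strict Implicit.
Unset Printing Implicit Defensive.

Local Open Scope classical_set_scope.
Local Open Scope ring_scope.

(** * Negative binomial coefficients *)

(** The coefficient of [q ^ l] in the expansion of [(1 - q) ^ (- r)]. *)
Definition nbinom_coef (R : realType) (r : R) (l : nat) : R :=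
  gbinom (r + l%:R - 1) l.

Section nbinom_coef.
Context {R : realType}.
Implicit Types (r q : R) (l n : nat).

Lemma nbinom_coef0 r : nbinom_coef r 0 = 1.
Proof. by rewrite /nbinom_coef /gbinom big_ord0 fact0 divr1. Qed.

Lemma gbinomS (x : R) l : l.+1%:R * gbinom x l.+1 = x * gbinom (x - 1) l.
Proof.
rewrite /gbinom big_ord_recl /= subr0 factS natrM.
under eq_bigr do rewrite /bump /= natrD opprD addrA.
by field; rewrite !nat1r !pnatr_eq0 /= -lt0n fact_gt0.
Qed.

(** Consecutive coefficients have ratio [(r + l) / (l + 1)], which tends to 1:
    this gives radius of convergence at least 1. *)
Lemma nbinom_coefS r l :
  l.+1%:R * nbinom_coef r l.+1 = (r + l%:R) * nbinom_coef r l.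
Proof.
rewrite /nbinom_coef gbinomS; congr (_ * gbinom _ _); rewrite -natr1; ring.
Qed.

(** Differentiating the series of parameter [r] term by term yields [r] times
    the series of parameter [r + 1]; the same absorption of the factor [l]
    computes the moments. *)
Lemma nbinom_coef_diffs r l :
  l.+1%:R * nbinom_coef r l.+1 = r * nbinom_coef (r + 1) l.
Proof.
rewrite /nbinom_coef /gbinom big_ord_recr /= factS natrM.
rewrite (_ : r + l.+1%:R - 1 - l%:R = r); last by rewrite -natr1; ring.
under eq_bigr do rewrite -natr1 (addrC _ 1) addrA.
by field; rewrite !nat1r !pnatr_eq0 /= -lt0n fact_gt0.
Qed.

Lemma nbinom_coef_pascal r l :
  nbinom_coef r l.+1 + nbinom_coef (r + 1) l = nbinom_coef (r + 1) l.+1.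
Proof.
have l0 : (l.+1%:R : R) != 0 by rewrite pnatr_eq0.
apply: (mulfI l0); rewrite mulrDr nbinom_coef_diffs nbinom_coefS -natr1; ring.
Qed.

Lemma nbinom_coef_gt0 r l : 0 < r -> 0 < nbinom_coef r l.
Proof.
move=> r0; elim: l => [|l IH]; first by rewrite nbinom_coef0.
by rewrite -(pmulr_rgt0 _ (ltr0Sn R l)) nbinom_coefS mulr_gt0// ltr_wpDr.
Qed.

(** * The negative binomial series *)

Lemma is_cvg_series_ratio (u : R^nat) (s : R) (N : nat) :
  0 < s < 1 -> (forall n, 0 <= u n) ->
  (forall n, (N <= n)%N -> u n.+1 <= s * u n) -> cvgn (series u).
Proof.
move=> /andP[s0 s1] u0 us.
(* This constant makes the geometric bound hold for every index up to N, and
   the ratio bound propagates it beyond. *)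
pose C := \sum_(i < N.+1) u i / s ^+ i.
have uC n : u n <= geometric C s n.
  rewrite /geometric/=; have [nN|Nn] := leqP n N.
    rewrite -ler_pdivrMr ?exprn_gt0// /C.
    rewrite (bigD1 (Ordinal (nN : (n < N.+1)%N)))//= lerDl.
    by apply: sumr_ge0 => i _; rewrite divr_ge0// exprn_ge0// ltW.
  elim: n Nn => // n IH; rewrite ltnS leq_eqVlt => /orP[/eqP Nn|Nn].
    rewrite -Nn (le_trans (us _ _))// exprS mulrCA ler_wpM2l ?(ltW s0)//.
    rewrite -ler_pdivrMr ?exprn_gt0// /C big_ord_recr/= lerDr.
    by apply: sumr_ge0 => i _; rewrite divr_ge0// exprn_ge0// ltW.
  rewrite (le_trans (us _ (ltnW Nn)))// exprS mulrCA ler_wpM2l ?(ltW s0)//.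
  exact: IH.
apply: (series_le_cvg u0 _ uC).
  by move=> n; exact: le_trans (u0 n) (uC n).
by apply: is_cvg_geometric_series; rewrite ger0_norm ?ltW.
Qed.

Lemma is_cvg_nbinom_series r q : 0 < r -> `|q| < 1 ->
  cvgn (pseries (nbinom_coef r) q).
Proof.
move=> r0 q1; pose K := (1 + `|q|) / 2.
have [q0 Kq K1] : [/\ 0 <= `|q|, `|q| < K & K < 1].
  by split=> //; rewrite /K; [lra|lra].
apply: (@is_cvg_pseries_inside _ _ K); last by rewrite [ltRHS]ger0_norm//; lra.
pose s := (1 + K) / 2.
have s01 : 0 < s < 1 by apply/andP; split; rewrite /s; lra.
have Ks : 0 < s - K by rewrite /s; lra.
(* The ratio of consecutive terms is (r + n) * K / (n + 1), which is at most s
   as soon as n >= r * K / (s - K). *)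
apply: (@is_cvg_series_ratio _ s (Num.truncn (r * K / (s - K))).+1) => // n.
  by rewrite mulr_ge0 ?exprn_ge0 ?(ltW (nbinom_coef_gt0 _ _))//; lra.
rewrite -(ler_nat R) => /(lt_le_trans (truncnS_gt _)).
rewrite ltr_pdivrMr// => nK.
rewrite -(ler_pM2l (ltr0Sn R n)) mulrA nbinom_coefS exprS /=.
set c := nbinom_coef r n; set k := K ^+ n.
rewrite [leLHS](_ : _ = (r + n%:R) * K * (c * k)); last by ring.
rewrite [leRHS](_ : _ = n.+1%:R * s * (c * k)); last by ring.
rewrite ler_wpM2r//; last by rewrite -natr1; lra.
by rewrite mulr_ge0 ?exprn_ge0 ?(ltW (nbinom_coef_gt0 _ _))//; lra.
Qed.

Lemma nbinom_series_diffs r : pseries_diffs (nbinom_coef r) =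
  (fun l => r * nbinom_coef (r + 1) l).
Proof. by apply/funext => l; exact: nbinom_coef_diffs. Qed.

(** Multiplying by [1 - q] lowers the parameter by 1: on partial sums this is
    the Pascal rule, up to a boundary term that vanishes in the limit. *)
Lemma nbinom_series_pascal r q : 0 < r -> `|q| < 1 ->
  (1 - q) * limn (pseries (nbinom_coef (r + 1)) q)
  = limn (pseries (nbinom_coef r) q).
Proof.
move=> r0 q1; have r10 : 0 < r + 1 by rewrite addr_gt0.
have cr := is_cvg_nbinom_series r0 q1.
have cr1 := is_cvg_nbinom_series r10 q1.
have partial n : (1 - q) * pseries (nbinom_coef (r + 1)) q n.+1
    = pseries (nbinom_coef r) q n.+1 - q * (nbinom_coef (r + 1) n * q ^+ n).
  elim: n => [|n IH].
    rewrite /pseries /series/= !big_nat1 !nbinom_coef0; ring.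
  rewrite /pseries /series/= in IH *.
  rewrite big_nat_recr//= mulrDr IH [X in _ = X - _]big_nat_recr//=.
  rewrite -nbinom_coef_pascal !exprS; ring.
have qn0 : (fun n => q * (nbinom_coef (r + 1) n * q ^+ n)) @ \oo --> q * 0.
  by apply: cvgMr; exact: cvg_series_cvg_0 cr1.
have lhs : (fun n => (1 - q) * pseries (nbinom_coef (r + 1)) q n.+1) @ \oo
    --> (1 - q) * limn (pseries (nbinom_coef (r + 1)) q).
  apply: cvgMr.
  by rewrite (cvg_shiftS (pseries (nbinom_coef (r + 1)) q)).
have rhs : (fun n => pseries (nbinom_coef r) q n.+1
      - q * (nbinom_coef (r + 1) n * q ^+ n)) @ \oo
    --> limn (pseries (nbinom_coef r) q) - q * 0.
  apply: cvgB => //.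
  by rewrite (cvg_shiftS (pseries (nbinom_coef r) q)).
rewrite -(cvg_lim _ lhs)//; under eq_fun do rewrite partial.
by rewrite (cvg_lim _ rhs)// mulr0 subr0.
Qed.

Lemma is_derive_nbinom_series r (x : R) : 0 < r -> `|x| < 1 ->
  is_derive x (1 : R) (fun z => limn (pseries (nbinom_coef r) z))
    (r * limn (pseries (nbinom_coef (r + 1)) x)).
Proof.
move=> r0 x1; have r10 : 0 < r + 1 by rewrite addr_gt0.
have r20 : 0 < r + 1 + 1 by rewrite addr_gt0.
pose K := (1 + `|x|) / 2.
have K0 : 0 <= K by rewrite /K; have := normr_ge0 x; lra.
have K1 : `|K| < 1 by rewrite ger0_norm// /K; lra.
have cvgZ (a s : R) : 0 < s ->
    forall z : R, `|z| < 1 -> pseries (fun l => a * nbinom_coef s l) z @ \oo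
      --> a * limn (pseries (nbinom_coef s) z).
  move=> s0 z z1.
  rewrite (_ : pseries _ _ = fun n => a * pseries (nbinom_coef s) z n).
    by apply: cvgMr; exact: is_cvg_nbinom_series.
  apply/funext => n; rewrite /pseries /series/= mulr_sumr.
  by apply: eq_bigr => i _; rewrite mulrA.
rewrite -(cvg_lim _ (cvgZ r _ r10 x x1))// -nbinom_series_diffs.
apply: (@pseries_snd_diffs _ _ K).
- exact: is_cvg_nbinom_series.
- by rewrite nbinom_series_diffs; apply/cvg_ex; eexists; exact: cvgZ.
- rewrite nbinom_series_diffs /pseries_diffs.
  under [X in pseries X]eq_fun do rewrite mulrCA nbinom_coef_diffs mulrA.
  by apply/cvg_ex; eexists; exact: cvgZ.
- by rewrite (ger0_norm K0) /K; lra.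
Qed.

(** Let [S] be the sum of the series. The two previous lemmas combine into the
    differential equation [(1 - z) * S'(z) = r * S(z)], so that
    [S(z) * (1 - z) `^ r] has zero derivative; it equals 1 at 0. *)
Lemma nbinom_seriesE r q : 0 < r -> 0 <= q < 1 ->
  limn (pseries (nbinom_coef r) q) = (1 - q) `^ (- r).
Proof.
move=> r0 /andP[q0 q1].
pose f (z : R) := limn (pseries (nbinom_coef r) z) * (1 - z) `^ r.
have df z : `|z| < 1 -> is_derive z (1 : R) f 0.
  move=> z1; have z1' : 0 < 1 - z by have := ler_norm z; lra.
  have dS := is_derive_nbinom_series r0 z1.
  have dB : is_derive z (1 : R) (fun z : R => 1 - z) (- 1).
    by rewrite -[- 1](add0r); apply: is_deriveB.
  have dP := @is_derive1_comp R (@powR R ^~ r) (fun z => 1 - z) z _ _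
    (is_derive1_powR r z1') dB.
  have := is_deriveM dS dP.
  congr is_derive.
  rewrite -(nbinom_series_pascal r0 z1) /GRing.scale/= /comp.
  have -> : (1 - z) `^ r = (1 - z) * (1 - z) `^ (r - 1).
    by rewrite mulr_powRB1// ltW.
  ring.
have f1 : f q = f 0.
  have zq z : z \in `[0, q] -> `|z| < 1.
    rewrite in_itv/= => /andP[z0 zq]; rewrite ger0_norm//; lra.
  have [z _] : exists2 c, c \in `[0, q] &
      f q - f 0 = (cst 0 : R -> R) c * (q - 0).
    apply: MVT_segment => //.
      by move=> z zI; apply: df; apply: zq; exact: subset_itv_oo_cc.
    apply: derivable_within_continuous => z zI.
    exact: (@ex_derive _ _ _ _ _ _ _ (df z (zq _ zI))).
  by rewrite /= mul0r => /eqP; rewrite subr_eq0 => /eqP.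
have f0 : f 0 = 1.
  rewrite /f subr0 powR1 mulr1; apply: cvg_lim => //.
  rewrite -(cvg_shiftS (pseries (nbinom_coef r) 0)).
  rewrite (_ : [sequence _]_n = cst 1); first exact: cvg_cst.
  apply/funext => n.
  rewrite /pseries /series/= big_nat_recl//= nbinom_coef0 mulr1 big1 ?addr0//.
  by move=> i _; rewrite exprS mul0r mulr0.
have p0 : (1 - q) `^ r != 0 by rewrite gt_eqF// powR_gt0// subr_gt0.
by rewrite powRN -(mulfK p0 (limn _)) -/(f q) f1 f0 mul1r.
Qed.
End nbinom_coef.

(** * Moment series *)

Lemma nneseries_shift (R : realType) (f : (\bar R)^nat) :
  (forall n, 0 <= f n)%E -> f 0%N = 0%E ->
  (\sum_(0 <= n <oo) f n = \sum_(0 <= n <oo) f n.+1)%E.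
Proof.
move=> f0 f00; rewrite nneseries_recl// f00 add0e -(nneseries_addn 1)//.
by under eq_eseriesr do rewrite addn1.
Qed.

Section nbinom_moments.
Context {R : realType} (r q : R).
Hypotheses (r0 : 0 < r) (q01 : 0 <= q < 1).

Let term_ge0 (s : R) l : 0 < s -> 0 <= nbinom_coef s l * q ^+ l.
Proof.
case/andP: q01 => q0 _ s0.
by rewrite mulr_ge0 ?exprn_ge0// ltW// nbinom_coef_gt0.
Qed.

Lemma nneseries_nbinom (s : R) : 0 < s ->
  (\sum_(0 <= l <oo) (nbinom_coef s l * q ^+ l)%:E = ((1 - q) `^ (- s))%:E)%E.
Proof.
move=> s0; rewrite -nbinom_seriesE// -EFin_lim.
  by congr (limn _); apply/funext => n; rewrite /= /pseries /series/= sumEFin.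
apply: is_cvg_nbinom_series => //.
by case/andP: q01 => q0 q1; rewrite ger0_norm.
Qed.

Lemma nneseries_nbinom_moment1 (s : R) : 0 < s ->
  (\sum_(0 <= l <oo) (l%:R * (nbinom_coef s l * q ^+ l))%:E
   = (s * q * (1 - q) `^ (- (s + 1)))%:E)%E.
Proof.
move=> s0; case/andP: (q01) => q0 q1.
rewrite nneseries_shift; last 2 first.
  by move=> l; rewrite lee_fin mulr_ge0// term_ge0.
  by rewrite mul0r.
rewrite EFinM -nneseries_nbinom ?addr_gt0// -nneseriesZl; last first.
  by move=> l _; rewrite lee_fin term_ge0// addr_gt0.
apply: eq_eseriesr => l _; rewrite -EFinM; congr EFin.
rewrite mulrA nbinom_coef_diffs exprS; ring.
Qed.

(** Absorbing one factor [l] leaves [l + 1] in front of the coefficients of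
    parameter [r + 1], that is, a first moment plus the plain series. *)
Lemma nneseries_nbinom_moment2 :
  (\sum_(0 <= l <oo) (l%:R ^+ 2 * (nbinom_coef r l * q ^+ l))%:E
   = (r * q * (1 + r * q) * (1 - q) `^ (- (r + 2)))%:E)%E.
Proof.
case/andP: (q01) => q0 q1; have r10 : 0 < r + 1 by rewrite addr_gt0.
have r20 : r + 1 + 1 = r + 2 by ring.
rewrite nneseries_shift; last 2 first.
  by move=> l; rewrite lee_fin mulr_ge0// ?term_ge0// sqr_ge0.
  by rewrite expr0n mul0r.
under eq_eseriesr => l _.
  rewrite (_ : _ * _ = r * q * (l%:R * (nbinom_coef (r + 1) l * q ^+ l)
      + nbinom_coef (r + 1) l * q ^+ l)); last first.
    rewrite expr2 mulrACA [_ * nbinom_coef _ _]nbinom_coef_diffs exprS.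
    rewrite -natr1; ring.
  rewrite EFinM EFinD; over.
rewrite nneseriesZl; last first.
  by move=> l _; rewrite -EFinD lee_fin addr_ge0 ?term_ge0//
    mulr_ge0// term_ge0.
rewrite nneseriesD; last 2 first.
- by move=> l _ _; rewrite lee_fin mulr_ge0// term_ge0.
- by move=> l _ _; rewrite lee_fin term_ge0.
rewrite nneseries_nbinom_moment1// nneseries_nbinom// r20 -EFinD -EFinM.
have -> : (1 - q) `^ (- (r + 1)) = (1 - q) * (1 - q) `^ (- (r + 2)).
  rewrite -r20 !powRN
    -(mulr_powRB1 _ (_ : 0 < r + 1 + 1)) ?addr_gt0//; last lra.
  rewrite addrK; field.
  by rewrite gt_eqF ?powR_gt0 ?subr_gt0// gt_eqF// subr_gt0.
congr EFin; ring.
Qed.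

End nbinom_moments.

(** * Moments of a negative binomial variable *)

(** When the masses at the natural numbers sum to 1, the preimages of the
    naturals cover the sample space up to a negligible set, and the integrand is
    constant on each of them. *)
Lemma ge0_integral_pmf_nat (R : realType) d (T : measurableType d)
    (P : probability T R) (X : {RV P >-> R}) (f : R -> R) :
  (\sum_(0 <= l <oo) (pmf X l%:R)%:E = 1)%E ->
  measurable_fun [set: R] f -> (forall x, 0 <= f x) ->
  (\int[P]_w (f (X w))%:E = \sum_(0 <= l <oo) (f l%:R * pmf X l%:R)%:E)%E.
Proof.
move=> pmf1 mf f0; pose A l := X @^-1` [set l%:R].
have mA l : measurable (A l) by exact: measurable_sfunP.
have mD : measurable (\bigcup_l A l) by exact: bigcup_measurable.
have PA l : P (A l) = (pmf X l%:R)%:E by rewrite /pmf fineK// fin_num_measure.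
have tA : trivIset setT A.
  apply/trivIsetP => i j _ _ ij; rewrite -subset0 => w [/= Xi Xj].
  by move/eqP: ij; apply; apply/eqP; rewrite -(eqr_nat R) -Xi -Xj.
have PD : P (\bigcup_l A l) = 1%E.
  rewrite measure_semi_bigcup// -pmf1.
  apply: eq_eseriesr => l _; exact: PA.
have mfX : measurable_fun setT (EFin \o f \o X).
  by apply/measurable_EFinP; exact: measurableT_comp.
rewrite (@ge0_negligible_integral _ _ _ _ _ (~` \bigcup_l A l))//=; first last.
- by rewrite probability_setC// PD subee.
- by move=> w _; rewrite lee_fin.
- exact: measurableC.
rewrite setTD setCK ge0_integral_bigcup//; last 2 first.
- exact: measurable_funS mfX.
- by move=> w _; rewrite lee_fin.
apply: eq_eseriesr => l _.
rewrite (eq_integral (cst (f l%:R)%:E)); last by move=> w; rewrite inE => /= ->.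
rewrite integral_cst// EFinM; congr (_ * _)%E; exact: PA.
Qed.

Section negative_binomial_moments.
Context (R : realType) d (T : measurableType d) (P : probability T R).
Context (r p : R) (X : {RV P >-> R}).
Hypotheses (r0 : 0 < r) (p01 : 0 < p <= 1) (hX : negative_binomial r p X).

Let q01 : 0 <= 1 - p < 1.
Proof. by case/andP: p01 => p0 p1; apply/andP; split; lra. Qed.

Let q1E : 1 - (1 - p) = p. Proof. by ring. Qed.

Lemma negative_binomial_pmfE l :
  pmf X l%:R = p `^ r * (nbinom_coef r l * (1 - p) ^+ l).
Proof. rewrite hX nbinom_pmfE /nbinom_coef; ring. Qed.

Let coef_ge0 l : 0 <= nbinom_coef r l * (1 - p) ^+ l.
Proof.
by case/andP: q01 => q0 _; rewrite mulr_ge0 ?exprn_ge0// ltW// nbinom_coef_gt0.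
Qed.

Lemma negative_binomial_sum_pmf :
  (\sum_(0 <= l <oo) (pmf X l%:R)%:E = 1)%E.
Proof.
case/andP: p01 => p0 _.
under eq_eseriesr do rewrite negative_binomial_pmfE EFinM.
rewrite nneseriesZl; last by move=> l _; rewrite lee_fin.
rewrite nneseries_nbinom// q1E -EFinM -powRD ?(gt_eqF p0) ?implybT//.
by rewrite subrr powRr0.
Qed.

Lemma negative_binomial_integral (f : R -> R) :
  measurable_fun [set: R] f -> (forall x, 0 <= f x) ->
  (\int[P]_w (f (X w))%:E = (p `^ r)%:E *
    \sum_(0 <= l <oo) (f l%:R * (nbinom_coef r l * (1 - p) ^+ l))%:E)%E.
Proof.
move=> mf f0.
rewrite (ge0_integral_pmf_nat negative_binomial_sum_pmf)//.
rewrite -nneseriesZl; last by move=> l _; rewrite lee_fin mulr_ge0.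
apply: eq_eseriesr => l _; rewrite negative_binomial_pmfE -EFinM.
by rewrite mulrCA.
Qed.

Lemma negative_binomial_sqr_integral :
  (\int[P]_w (X w ^+ 2)%:E
   = (r * (1 - p) * (1 + r * (1 - p)) / p ^+ 2)%:E)%E.
Proof.
case/andP: p01 => p0 _.
rewrite (negative_binomial_integral (f := fun x => x ^+ 2)); last 2 first.
  exact: measurable_funX.
  by move=> x; exact: sqr_ge0.
rewrite nneseries_nbinom_moment2// q1E -EFinM; congr EFin.
rewrite mulrCA -powRD ?(gt_eqF p0) ?implybT// opprD addrA subrr add0r.
by rewrite powRN powR_mulrn// ltW.
Qed.

Lemma negative_binomial_Lfun2 : (X : T -> R) \in Lfun P 2%:E.
Proof.
rewrite inE; apply/andP; split; rewrite inE/=; first exact: measurable_funP.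
rewrite /finite_norm unlock poweR_lty//=.
under eq_integral do rewrite powR_mulrn// real_normK ?num_real//.
by rewrite negative_binomial_sqr_integral ltry.
Qed.

(** Nothing prevents [X] from being negative on a negligible set, so positive
    and negative parts are integrated separately. *)
Lemma negative_binomial_expectation : ('E_P[X] = (r * (1 - p) / p)%:E)%E.
Proof.
case/andP: p01 => p0 _.
rewrite unlock integralE.
have mid : measurable_fun [set: R] (fun x : R => x) by exact: measurable_id.
have -> : (\int[P]_x (EFin \o X)^\+ x = (r * (1 - p) / p)%:E)%E.
  rewrite (_ : (fun x => _) = fun w => (Num.max (X w) 0)%:E); last first.
    by apply/funext => w; rewrite funeposE/= EFin_max.
  rewrite (negative_binomial_integral (f := fun x => Num.max x 0));
    last 2 first.
    exact: measurable_maxr.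
    by move=> x; rewrite le_max lexx orbT.
  under eq_eseriesr do rewrite max_l//.
  rewrite nneseries_nbinom_moment1// q1E -EFinM; congr EFin.
  rewrite mulrCA -powRD ?(gt_eqF p0) ?implybT// opprD addrA subrr add0r.
  by rewrite powR_inv1// ltW.
have -> : (\int[P]_x (EFin \o X)^\- x = 0)%E.
  rewrite (_ : (fun x => _) = fun w => (Num.max (- X w) 0)%:E); last first.
    by apply/funext => w; rewrite funenegE/= EFin_max.
  rewrite (negative_binomial_integral (f := fun x => Num.max (- x) 0));
    last 2 first.
    by apply: measurable_maxr => //; exact: measurable_oppr.
    by move=> x; rewrite le_max lexx orbT.
  rewrite eseries0 ?mule0// => l _ _.
  by rewrite max_r ?mul0r// oppr_le0.
by rewrite sube0.
Qed.

Lemma negative_binomial_variance : ('V_P[X] = (r * (1 - p) / p ^+ 2)%:E)%E.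
Proof.
case/andP: p01 => p0 _.
rewrite varianceE; last exact: negative_binomial_Lfun2.
rewrite negative_binomial_expectation unlock negative_binomial_sqr_integral.
rewrite -EFin_expe -EFinB; congr EFin.
by field; rewrite gt_eqF.
Qed.

Lemma negative_binomial_neq0 : P (~` (X @^-1` [set 0])) = (1 - p `^ r)%:E.
Proof.
rewrite probability_setC; last exact: measurable_sfunP.
rewrite EFinB; congr (_ - _)%E.
have := negative_binomial_pmfE 0.
rewrite /pmf nbinom_coef0 mulr1 mulr1 => <-.
by rewrite fineK// fin_num_measure//; exact: measurable_sfunP.
Qed.

(** * Deviation from the mean *)

(** The value 0 is at distance [r * (1 - p) / p] from the mean while the
    standard deviation is [Num.sqrt (r * (1 - p)) / p]; the bound on
    [r * (1 - p)] thus excludes [X = 0] from the event. For [p = 1] both sides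
    of the inequality defining the event are 0 where [X = 0], so strictness of
    [p < 1] is essential. *)
Lemma negative_binomial_deviation (y : R) : 0 < y -> p < 1 ->
    r * (1 - p) < y ^+ 2 ->
  (P [set w | (y * Num.sqrt (fine 'V_P[X]) <= `|X w - fine 'E_P[X]|)%R]
   <= (1 - p `^ r)%:E)%E.
Proof.
move=> y0 p1 ry; case/andP: p01 => p0 _.
rewrite -negative_binomial_neq0 negative_binomial_variance.
rewrite negative_binomial_expectation/=.
set v := r * (1 - p); have v0 : 0 < v by rewrite mulr_gt0// subr_gt0.
rewrite sqrtrM ?(ltW v0)// sqrtrV ?exprn_ge0 ?(ltW p0)// sqrtr_sqr gtr0_norm//.
apply: le_measure.
- rewrite inE.
  have -> : [set w | y * (Num.sqrt v / p) <= `|X w - v / p|]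
      = (fun w => `|X w - v / p|) @^-1` `[y * (Num.sqrt v / p), +oo[.
    by apply/seteqP; split => w /=; rewrite in_itv/= andbT.
  rewrite -[_ @^-1` _]setTI.
  have : measurable_fun setT (fun w => `|X w - v / p|).
    by apply: measurableT_comp => //; exact: measurable_funB.
  by apply => //; exact: measurable_itv.
- by rewrite inE; apply: measurableC; exact: measurable_sfunP.
- move=> w /= + Xw0; rewrite Xw0 sub0r normrN ger0_norm; last first.
    by rewrite divr_ge0 ?ltW.
  rewrite mulrA ler_pM2r ?invr_gt0//.
  have sv0 : 0 < Num.sqrt v by rewrite sqrtr_gt0.
  have sy : Num.sqrt v < y.
    by rewrite -(ltr_pXn2r (ltn0Sn 1)) ?nnegrE ?(ltW y0) ?(ltW sv0)//
      sqr_sqrtr ?ltW.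
  rewrite -[leRHS]sqr_sqrtr ?(ltW v0)// expr2 ler_pM2r// leNgt sy.
  by [].
Qed.
End negative_binomial_moments.

Theorem proposition3p3 (R : realType) (r : R) (hr : 0 < r)
    (d : R -> measure_display) (T : forall p : R, measurableType (d p))
    (P : forall p : R, probability (T p) R)
    (X : forall p : R, {RV (P p) >-> R})
    (hX : forall p : R, 0 < p <= 1 -> negative_binomial r p (X p))
    (y : R) (hy : 0 < y) :
  ereal_inf
    [set P p [set w | y * Num.sqrt (fine 'V_(P p)[X p])
                      <= `|X p w - fine 'E_(P p)[X p]| ]
    | p in [set p : R | 0 < p <= 1]] = 0%E.
Proof.
apply/eqP; rewrite eq_le; apply/andP; split; last first.
  by apply: le_ereal_inf_tmp => _ [p _ <-]; exact: measure_ge0.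
apply/lee_addgt0Pr => e e0; rewrite add0e.
have powR_cvg1 : (p `^ r) @[p --> (1 : R)^'-] --> (1 : R).
  apply: cvg_at_left_filter.
  have [d1 _] := is_derive1_powR r (ltr01 : 0 < 1 :> R).
  have := differentiable_continuous ((derivable1_diffP _ _).1 d1).
  by rewrite /prop_for /continuous_at /= powR1.
have [p [p0 p1 py pe]] : exists p : R, [/\ 0 < p, p < 1,
    1 - y ^+ 2 / r < p & 1 - e < p `^ r].
  apply: (@filter_ex _ (1 : R)^'-); near=> p; split; near: p.
  - exact: nbhs_left_gt.
  - exact: nbhs_left_lt.
  - by apply: nbhs_left_gt; rewrite ltrBlDr ltrDl divr_gt0// exprn_gt0.
  - by apply: (cvgr_gt (1 : R)) => //; rewrite ltrBlDr ltrDl.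
have p01 : 0 < p <= 1 by rewrite p0 ltW.
apply: ge_ereal_inf; eexists; first by exists p.
have ry : r * (1 - p) < y ^+ 2 by rewrite mulrC -ltr_pdivlMr//; lra.
apply: (le_trans (negative_binomial_deviation hr p01 (hX p p01) hy p1 ry)).
by rewrite lee_fin; lra.
Unshelve. all: by end_near. Qed.
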